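(* $\mathsf{RCA}_0$ does not prove the following statement: for every complete countable linear order $(X,\prec)$, the associated ordered space (that is, $X$ with its order topology) is compact.
   Context: All definitions are made in second-order arithmetic. Finite sets are coded by natural numbers. An enumerable set is a nondecreasing sequence $A=\langle a_n\rangle_{n=0}^\infty$ of finite sets, representing $\bigcup_n a_n$ (which need not exist as a set); $x\in A$ abbreviates $(\exists n)(x\in a_n)$. A countable second-countable space is a triple $(X,\mathcal U,k)$ where $X\subseteq\mathbb N$ is a set, $\mathcal U=\langle U_i\rangle_{i\in I}$ is an indexed sequence of subsets of $X$ and $k:X\times I\times I\to I$ is a function such that every $x\in X$ is in some $U_i$, and whenever $x\in U_i\cap U_j$ then $x\in U_{k(x,i,j)}\subseteq U_i\cap U_j$. It is compact if for every enumerable set $A\subseteq I$ with $X=\bigcup_{i\in A}U_i$ there is a finite set $a\subseteq A$ with $X=\bigcup_{i\in a}U_i$. For a countable linear order $(X,\prec)$ (with $X\subseteq\mathbb N$), the associated ordered space is $(X,\mathcal U_\prec,k_\prec)$, where $I=(X\cup\{\pm\infty\})^2$, $\mathcal U_\prec=\langle (x_0,x_1)\rangle_{\langle x_0,x_1\rangle\in I}$ is the sequence of open intervals, and $k_\prec(x,\langle x_0,x_1\rangle,\langle x_0',x_1'\rangle)=\langle\max(x_0,x_0'),\min(x_1,x_1')\rangle$. The linear order $(X,\prec)$ is complete if for every partition $X=A^-\cup A^+$ into sets such that $x^-\prec x^+$ for all $x^-\in A^-$ and $x^+\in A^+$ (where one of the two pieces may be empty), either $A^-$ has a maximal element or $A^+$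 has a minimal element. *)

(* Defs.v *)
(* Plain inductive types and lists of the standard library; no further library. *)
From Stdlib Require Import List.
Import ListNotations.

(** * The language of second-order arithmetic

    Number variables and set variables are two independent families of
    de Bruijn indices: [All1]/[Ex1] bind number index 0, [All2]/[Ex2] bind
    set index 0.  Equality is primitive only between numbers. *)

Inductive term : Type :=
| Var (n : nat)
| Zero
| One
| Plus (t u : term)
| Times (t u : term).

Inductive form : Type :=
| Bot
| EqN (t u : term)
| LtN (t u : term)
| Mem (t : term) (X : nat)
| And (p q : form)
| Or (p q : form)
| Imp (p q : form)
| All1 (p : form)
| Ex1 (p : form)
| All2 (p : form)
| Ex2 (p : form).

Definition Neg (p : form) : form := Imp p Bot.
Definition Iff (p q : form) : form := And (Imp p q) (Imp q p).

Definition scons {A : Type} (a : A) (s : nat -> A) (n : nat) : A :=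
  match n with 0 => a | S k => s k end.

Fixpoint tsubst (s : nat -> term) (t : term) : term :=
  match t with
  | Var n => s n
  | Zero => Zero
  | One => One
  | Plus t u => Plus (tsubst s t) (tsubst s u)
  | Times t u => Times (tsubst s t) (tsubst s u)
  end.

Definition tshift : term -> term := tsubst (fun n => Var (S n)).
Definition upN (s : nat -> term) : nat -> term :=
  scons (Var 0) (fun n => tshift (s n)).
Definition upS (r : nat -> nat) : nat -> nat :=
  scons 0 (fun n => S (r n)).

(** Simultaneous substitution of terms for number variables and renaming of
    set variables (the only set terms are variables). *)
Fixpoint subst (s : nat -> term) (r : nat -> nat) (p : form) : form :=
  match p with
  | Bot => Bot
  | EqN t u => EqN (tsubst s t) (tsubst s u)
  | LtN t u => LtN (tsubst s t) (tsubst s u)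
  | Mem t X => Mem (tsubst s t) (r X)
  | And p q => And (subst s r p) (subst s r q)
  | Or p q => Or (subst s r p) (subst s r q)
  | Imp p q => Imp (subst s r p) (subst s r q)
  | All1 p => All1 (subst (upN s) r p)
  | Ex1 p => Ex1 (subst (upN s) r p)
  | All2 p => All2 (subst s (upS r) p)
  | Ex2 p => Ex2 (subst s (upS r) p)
  end.

Definition shiftN : form -> form := subst (fun n => Var (S n)) (fun X => X).
Definition shiftS : form -> form := subst Var S.
Definition instN (t : term) : form -> form :=
  subst (scons t Var) (fun X => X).
Definition instS (X : nat) : form -> form :=
  subst Var (scons X (fun Y => Y)).

(** * Provability: classical two-sorted natural deduction with equality

    [T] may contain formulas with free variables; they act as their universal
    closures, because the eigenvariable conditions of the quantifier rules
    (the shifts) constrain the context [G] only, not [T]. *)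

Inductive prv (T : form -> Prop) : list form -> form -> Prop :=
| prv_ax G p : T p -> prv T G p
| prv_hyp G p : List.In p G -> prv T G p
| prv_impI G p q : prv T (p :: G) q -> prv T G (Imp p q)
| prv_impE G p q : prv T G (Imp p q) -> prv T G p -> prv T G q
| prv_andI G p q : prv T G p -> prv T G q -> prv T G (And p q)
| prv_andE1 G p q : prv T G (And p q) -> prv T G p
| prv_andE2 G p q : prv T G (And p q) -> prv T G q
| prv_orI1 G p q : prv T G p -> prv T G (Or p q)
| prv_orI2 G p q : prv T G q -> prv T G (Or p q)
| prv_orE G p q r :
    prv T G (Or p q) -> prv T (p :: G) r -> prv T (q :: G) r -> prv T G r
| prv_raa G p : prv T (Neg p :: G) Bot -> prv T G p
| prv_allNI G p : prv T (map shiftN G) p -> prv T G (All1 p)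
| prv_allNE G p t : prv T G (All1 p) -> prv T G (instN t p)
| prv_exNI G p t : prv T G (instN t p) -> prv T G (Ex1 p)
| prv_exNE G p q :
    prv T G (Ex1 p) -> prv T (p :: map shiftN G) (shiftN q) -> prv T G q
| prv_allSI G p : prv T (map shiftS G) p -> prv T G (All2 p)
| prv_allSE G p X : prv T G (All2 p) -> prv T G (instS X p)
| prv_exSI G p X : prv T G (instS X p) -> prv T G (Ex2 p)
| prv_exSE G p q :
    prv T G (Ex2 p) -> prv T (p :: map shiftS G) (shiftS q) -> prv T G q
| prv_eqI G t : prv T G (EqN t t)
| prv_eqE G p t u :
    prv T G (EqN t u) -> prv T G (instN t p) -> prv T G (instN u p).

Definition proves (T : form -> Prop) (p : form) : Prop := prv T [] p.

(** * Named notation for formulas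

    [fm] is a formula still waiting for the number of number binders and of
    set binders above it.  A bound variable is remembered by its binder's
    level and turned into a de Bruijn index where it occurs, so that formulas
    can be written with ordinary named variables and [closed] yields the
    de Bruijn formula by computation. *)

Definition nvar : Type := nat -> term.
Definition svar : Type := nat -> nat.
Definition fm : Type := nat -> nat -> form.

Definition closed (P : fm) : form := P 0 0.

Definition fzero : nvar := fun _ => Zero.
Definition fone : nvar := fun _ => One.
Definition fplus (x y : nvar) : nvar := fun d => Plus (x d) (y d).
Definition ftimes (x y : nvar) : nvar := fun d => Times (x d) (y d).

Definition fbot : fm := fun _ _ => Bot.
Definition feq (x y : nvar) : fm := fun d _ => EqN (x d) (y d).
Definition flt (x y : nvar) : fm := fun d _ => LtN (x d) (y d).
Definition fmem (x : nvar) (X : svar) : fm := fun d e => Mem (x d) (X e).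
Definition fand (P Q : fm) : fm := fun d e => And (P d e) (Q d e).
Definition for_ (P Q : fm) : fm := fun d e => Or (P d e) (Q d e).
Definition fimp (P Q : fm) : fm := fun d e => Imp (P d e) (Q d e).
Definition fneg (P : fm) : fm := fun d e => Neg (P d e).
Definition fiff (P Q : fm) : fm := fun d e => Iff (P d e) (Q d e).
Definition fallN (F : nvar -> fm) : fm :=
  fun d e => All1 (F (fun d' => Var (d' - S d)) (S d) e).
Definition fexN (F : nvar -> fm) : fm :=
  fun d e => Ex1 (F (fun d' => Var (d' - S d)) (S d) e).
Definition fallS (F : svar -> fm) : fm :=
  fun d e => All2 (F (fun e' => e' - S e) d (S e)).
Definition fexS (F : svar -> fm) : fm :=
  fun d e => Ex2 (F (fun e' => e' - S e) d (S e)).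

Declare Scope so_scope.
Delimit Scope so_scope with SO.
Notation "0" := fzero : so_scope.
Notation "1" := fone : so_scope.
Notation "x + y" := (fplus x y) : so_scope.
Notation "x * y" := (ftimes x y) : so_scope.
Notation "x = y" := (feq x y) : so_scope.
Notation "x < y" := (flt x y) : so_scope.
Notation "x ∈ X" := (fmem x X) (at level 70) : so_scope.
Notation "¬ P" := (fneg P) (at level 75, right associativity) : so_scope.
Notation "P ∧ Q" := (fand P Q) (at level 80, right associativity) : so_scope.
Notation "P ∨ Q" := (for_ P Q) (at level 85, right associativity) : so_scope.
Notation "P → Q" := (fimp P Q)
  (at level 99, Q at level 200, right associativity) : so_scope.
Notation "P ↔ Q" := (fiff P Q) (at level 95, no associativity) : so_scope.
Notation "∀₁ x .. y , P" := (fallN (fun x => .. (fallN (fun y => P)) ..))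
  (at level 200, x binder, y binder, right associativity) : so_scope.
Notation "∃₁ x .. y , P" := (fexN (fun x => .. (fexN (fun y => P)) ..))
  (at level 200, x binder, y binder, right associativity) : so_scope.
Notation "∀₂ X .. Y , P" := (fallS (fun X => .. (fallS (fun Y => P)) ..))
  (at level 200, X binder, Y binder, right associativity) : so_scope.
Notation "∃₂ X .. Y , P" := (fexS (fun X => .. (fexS (fun Y => P)) ..))
  (at level 200, X binder, Y binder, right associativity) : so_scope.

Local Open Scope so_scope.

(** * The theory RCA₀ *)

Inductive basic_axiom : form -> Prop :=
| ax_succ_nonzero : basic_axiom (closed (∀₁ n, ¬ (n + 1 = 0)))
| ax_succ_inj : basic_axiom (closed (∀₁ m n, m + 1 = n + 1 → m = n))
| ax_plus_zero : basic_axiom (closed (∀₁ m, m + 0 = m))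
| ax_plus_succ : basic_axiom (closed (∀₁ m n, m + (n + 1) = (m + n) + 1))
| ax_times_zero : basic_axiom (closed (∀₁ m, m * 0 = 0))
| ax_times_succ : basic_axiom (closed (∀₁ m n, m * (n + 1) = (m * n) + m))
| ax_lt_zero : basic_axiom (closed (∀₁ m, ¬ (m < 0)))
| ax_lt_succ : basic_axiom (closed (∀₁ m n, m < n + 1 ↔ (m < n ∨ m = n))).

(** Bounded-quantifier formulas, with set parameters allowed; the [tshift]
    keeps the bounded variable out of the bound. *)
Inductive Delta00 : form -> Prop :=
| D_bot : Delta00 Bot
| D_eq t u : Delta00 (EqN t u)
| D_lt t u : Delta00 (LtN t u)
| D_mem t X : Delta00 (Mem t X)
| D_and p q : Delta00 p -> Delta00 q -> Delta00 (And p q)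
| D_or p q : Delta00 p -> Delta00 q -> Delta00 (Or p q)
| D_imp p q : Delta00 p -> Delta00 q -> Delta00 (Imp p q)
| D_all t p : Delta00 p -> Delta00 (All1 (Imp (LtN (Var 0) (tshift t)) p))
| D_ex t p : Delta00 p -> Delta00 (Ex1 (And (LtN (Var 0) (tshift t)) p)).

Inductive Sigma01 : form -> Prop :=
| Sigma01_intro p : Delta00 p -> Sigma01 (Ex1 p).

Inductive Pi01 : form -> Prop :=
| Pi01_intro p : Delta00 p -> Pi01 (All1 p).

(** [p 0 → (∀ n, p n → p (n + 1)) → ∀ n, p n], where [n] is index 0 of [p]. *)
Definition induction_for (p : form) : form :=
  Imp (instN Zero p)
    (Imp (All1 (Imp p (subst (scons (Plus (Var 0) One) (fun n => Var (S n)))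
                             (fun X => X) p)))
         (All1 p)).

(** [(∀ n, p n ↔ q n) → ∃ X, ∀ n, n ∈ X ↔ p n]; [shiftS] makes the new set
    [X] not occur in [p]. *)
Definition comprehension_for (p q : form) : form :=
  Imp (All1 (Iff p q)) (Ex2 (All1 (Iff (Mem (Var 0) 0) (shiftS p)))).

Inductive RCA0 : form -> Prop :=
| RCA0_basic p : basic_axiom p -> RCA0 p
| RCA0_induction p : Sigma01 p -> RCA0 (induction_for p)
| RCA0_comprehension p q :
    Sigma01 p -> Pi01 q -> RCA0 (comprehension_for p q).

(** * Coding in second-order arithmetic *)

(** The usual pairing [(x + y)² + x]; it is injective but not surjective. *)
Definition npair (x y : nvar) : nvar := (x + y) * (x + y) + x.
Notation "⟨ x , y ⟩" := (npair x y) (at level 0) : so_scope.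

(** Finite sets are coded with the β-function: the elements of
    [⟨k, ⟨m, n⟩⟩] are the [x < k] with [m (x + 1) + 1] dividing [n].
    Every number is admitted as a code (numbers not of this shape code the
    empty set), so a finite set has many codes. *)
Definition fin_mem (x c : nvar) : fm :=
  ∃₁ k m n, c = ⟨k, ⟨m, n⟩⟩ ∧ x < k ∧ ∃₁ q, n = (m * (x + 1) + 1) * q.

(** [A] is the graph of a total function on the numbers. *)
Definition number_sequence (A : svar) : fm :=
  (∀₁ z, z ∈ A → ∃₁ n a, z = ⟨n, a⟩) ∧
  (∀₁ n, ∃₁ a, ⟨n, a⟩ ∈ A ∧ ∀₁ b, ⟨n, b⟩ ∈ A → b = a).

Definition enumerable_set (A : svar) : fm :=
  number_sequence A ∧
  ∀₁ m n a b, (m < n ∨ m = n) ∧ ⟨m, a⟩ ∈ A ∧ ⟨n, b⟩ ∈ A →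
    ∀₁ x, fin_mem x a → fin_mem x b.

Definition enum_mem (x : nvar) (A : svar) : fm :=
  ∃₁ n a, ⟨n, a⟩ ∈ A ∧ fin_mem x a.

(** * Countable linear orders *)

Definition linear_order (X L : svar) : fm :=
  (∀₁ z, z ∈ L → ∃₁ x y, z = ⟨x, y⟩ ∧ x ∈ X ∧ y ∈ X) ∧
  (∀₁ x, x ∈ X → ¬ (⟨x, x⟩ ∈ L)) ∧
  (∀₁ x y z, x ∈ X ∧ y ∈ X ∧ z ∈ X →
     ⟨x, y⟩ ∈ L ∧ ⟨y, z⟩ ∈ L → ⟨x, z⟩ ∈ L) ∧
  (∀₁ x y, x ∈ X ∧ y ∈ X → ⟨x, y⟩ ∈ L ∨ x = y ∨ ⟨y, x⟩ ∈ L).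

(** The pieces of a partition may be empty. *)
Definition complete (X L : svar) : fm :=
  ∀₂ A B,
    (∀₁ x, x ∈ X ↔ (x ∈ A ∨ x ∈ B)) ∧
    (∀₁ x, ¬ (x ∈ A ∧ x ∈ B)) ∧
    (∀₁ x y, x ∈ A ∧ y ∈ B → ⟨x, y⟩ ∈ L) →
    (∃₁ m, m ∈ A ∧ ∀₁ x, x ∈ A → ¬ (⟨m, x⟩ ∈ L)) ∨
    (∃₁ m, m ∈ B ∧ ∀₁ x, x ∈ B → ¬ (⟨x, m⟩ ∈ L)).

(** * The ordered space of a linear order

    [X ∪ {±∞}] is coded by [-∞ ↦ 0], [+∞ ↦ 1], [x ↦ x + 2]. *)

Definition ninf : nvar := 0.
Definition pinf : nvar := 1.
Definition emb (x : nvar) : nvar := x + 1 + 1.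

Definition ext (X : svar) (u : nvar) : fm :=
  u = ninf ∨ u = pinf ∨ ∃₁ x, x ∈ X ∧ u = emb x.

Definition ext_lt (L : svar) (u v : nvar) : fm :=
  (u = ninf ∧ ¬ (v = ninf)) ∨
  (¬ (u = pinf) ∧ v = pinf) ∨
  (∃₁ x y, u = emb x ∧ v = emb y ∧ ⟨x, y⟩ ∈ L).

Definition ext_max (L : svar) (u v w : nvar) : fm :=
  (ext_lt L u v ∧ w = v) ∨ (¬ ext_lt L u v ∧ w = u).

Definition ext_min (L : svar) (u v w : nvar) : fm :=
  (ext_lt L u v ∧ w = u) ∨ (¬ ext_lt L u v ∧ w = v).

(** [(X, U, k)] is the ordered space of [(X, L)], with index set [I].  The
    sequence [U] is the set of pairs [⟨x, i⟩] with [x ∈ U_i], and [k] is the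
    graph of a function of three arguments. *)
Definition ordered_space (X L I U K : svar) : fm :=
  (∀₁ i, i ∈ I ↔ ∃₁ u v, i = ⟨u, v⟩ ∧ ext X u ∧ ext X v) ∧
  (∀₁ z, z ∈ U ↔ ∃₁ x u v, z = ⟨x, ⟨u, v⟩⟩ ∧ x ∈ X ∧ ⟨u, v⟩ ∈ I ∧
     ext_lt L u (emb x) ∧ ext_lt L (emb x) v) ∧
  (∀₁ z, z ∈ K ↔ ∃₁ x u v u' v' w w',
     z = ⟨⟨⟨x, ⟨u, v⟩⟩, ⟨u', v'⟩⟩, ⟨w, w'⟩⟩ ∧
     x ∈ X ∧ ⟨u, v⟩ ∈ I ∧ ⟨u', v'⟩ ∈ I ∧
     ext_max L u u' w ∧ ext_min L v v' w').

(** Compactness of a countable second-countable space [(X, U, k)] with index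
    set [I]; it does not depend on [k]. *)
Definition compact (X I U : svar) : fm :=
  ∀₂ A,
    enumerable_set A ∧
    (∀₁ i, enum_mem i A → i ∈ I) ∧
    (∀₁ x, x ∈ X ↔ ∃₁ i, enum_mem i A ∧ ⟨x, i⟩ ∈ U) →
    ∃₁ a,
      (∀₁ i, fin_mem i a → enum_mem i A) ∧
      (∀₁ x, x ∈ X ↔ ∃₁ i, fin_mem i a ∧ ⟨x, i⟩ ∈ U).

Definition complete_orders_compact : form :=
  closed (∀₂ X L, linear_order X L ∧ complete X L →
            ∀₂ I U K, ordered_space X L I U K → compact X I U).

(* Main.v *)
(** It suffices to find a Turing ideal, i.e. an ω-model of RCA₀, in which the
    statement fails.  Take an infinite decidable binary tree T all of whose
    nodes avoid, at level e + 1, the output of program e on input e; no decidable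
    path stays in T.  Order T by the in-order of the full binary tree.  A decidable
    cut without endpoints could be followed along a decidable path inside T, so T
    is complete in the model.  For the same reason every node has finite
    neighbourhoods, and an interval is seen to be finite as soon as it misses a
    level of T; so the finite intervals form an enumerable cover, which has no
    finite subcover because T is infinite.

    The ideal consists of the sets decidable by programs that may query the
    step-bounded halting function of these same programs. *)

From Stdlib Require Import List Arith Lia Bool Classical FunctionalExtensionality
  ConstructiveEpsilon Cantor.
Require Import Defs.
Import ListNotations.

(** * Soundness for ω-models *)

Fixpoint teval (s : nat -> nat) (t : term) : nat :=
  match t with
  | Var n => s n
  | Zero => 0
  | One => 1
  | Plus t u => teval s t + teval s u
  | Times t u => teval s t * teval s u
  end.

(** The number sort is the standard [nat], so a model is determined by the class [C] of its sets. *)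
Fixpoint sat (C : (nat -> Prop) -> Prop) (s : nat -> nat) (R : nat -> nat -> Prop)
    (p : form) : Prop :=
  match p with
  | Bot => False
  | EqN t u => teval s t = teval s u
  | LtN t u => teval s t < teval s u
  | Mem t X => R X (teval s t)
  | And p q => sat C s R p /\ sat C s R q
  | Or p q => sat C s R p \/ sat C s R q
  | Imp p q => sat C s R p -> sat C s R q
  | All1 p => forall n, sat C (scons n s) R p
  | Ex1 p => exists n, sat C (scons n s) R p
  | All2 p => forall X, C X -> sat C s (scons X R) p
  | Ex2 p => exists X, C X /\ sat C s (scons X R) p
  end.

Lemma teval_subst s r t : teval s (tsubst r t) = teval (fun n => teval s (r n)) t.
Proof. induction t; simpl; congruence. Qed.

Lemma teval_shift s n t : teval (scons n s) (tshift t) = teval s t.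
Proof. apply teval_subst. Qed.

Lemma scons_upN s n r :
  (fun k => teval (scons n s) (upN r k)) = scons n (fun k => teval s (r k)).
Proof.
  extensionality k; destruct k; simpl; [reflexivity | apply teval_shift].
Qed.

Lemma scons_upS (X : nat -> Prop) (R : nat -> nat -> Prop) r :
  (fun k => scons X R (upS r k)) = scons X (fun k => R (r k)).
Proof. extensionality k; now destruct k. Qed.

Lemma sat_subst C p : forall s R r q,
  sat C s R (subst r q p) <->
  sat C (fun n => teval s (r n)) (fun n => R (q n)) p.
Proof.
  induction p; intros s R r q0; simpl; rewrite ?teval_subst; try tauto.
  - rewrite IHp1, IHp2; tauto.
  - rewrite IHp1, IHp2; tauto.
  - rewrite IHp1, IHp2; tauto.
  - split; intros H n; specialize (H n); [rewrite IHp, scons_upN in H | rewrite IHp, scons_upN];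
      exact H.
  - split; intros [n H]; exists n; [rewrite IHp, scons_upN in H | rewrite IHp, scons_upN];
      exact H.
  - split; intros H X HX; specialize (H X HX);
      [rewrite IHp, scons_upS in H | rewrite IHp, scons_upS]; exact H.
  - split; intros (X & HX & H); exists X; split; trivial;
      [rewrite IHp, scons_upS in H | rewrite IHp, scons_upS]; exact H.
Qed.

Lemma sat_shiftN C s R n p : sat C (scons n s) R (shiftN p) <-> sat C s R p.
Proof. unfold shiftN; rewrite sat_subst; reflexivity. Qed.

Lemma sat_shiftS C s R X p : sat C s (scons X R) (shiftS p) <-> sat C s R p.
Proof. unfold shiftS; rewrite sat_subst; reflexivity. Qed.

Lemma sat_instN C s R t p : sat C s R (instN t p) <-> sat C (scons (teval s t) s) R p.
Proof.
  unfold instN; rewrite sat_subst.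
  replace (fun n => teval s (scons t Var n)) with (scons (teval s t) s); [reflexivity|].
  extensionality k; now destruct k.
Qed.

Lemma sat_instS C s R X p : sat C s R (instS X p) <-> sat C s (scons (R X) R) p.
Proof.
  unfold instS; rewrite sat_subst.
  replace (fun n => R (scons X (fun Y => Y) n)) with (scons (R X) R); [reflexivity|].
  extensionality k; now destruct k.
Qed.

(** Axioms may have free variables and the quantifier rules shift only the context, so the theory is
    assumed valid under every assignment with sets in [C]. *)
Lemma soundness (C : (nat -> Prop) -> Prop) (T : form -> Prop) G p :
  prv T G p ->
  (forall q s R, T q -> (forall n, C (R n)) -> sat C s R q) ->
  forall s R, (forall n, C (R n)) -> (forall q, In q G -> sat C s R q) -> sat C s R p.
Proof.
  intros H HT; induction H; intros s R HR HG.
  - now apply HT.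
  - now apply HG.
  - intros Hp; apply IHprv; trivial; intros r [<- | Hr]; auto.
  - exact (IHprv1 s R HR HG (IHprv2 s R HR HG)).
  - split; auto.
  - exact (proj1 (IHprv s R HR HG)).
  - exact (proj2 (IHprv s R HR HG)).
  - left; auto.
  - right; auto.
  - destruct (IHprv1 s R HR HG);
      [apply IHprv2 | apply IHprv3]; trivial; intros x [<- | Hx]; auto.
  - apply NNPP; intros Hp; apply (IHprv s R HR); intros x [<- | Hx]; auto.
  - intros n; apply IHprv; trivial.
    intros q (x & <- & Hx)%in_map_iff; apply sat_shiftN; auto.
  - apply sat_instN, (IHprv s R HR HG).
  - exists (teval s t); apply sat_instN; auto.
  - destruct (IHprv1 s R HR HG) as [n Hn].
    apply (sat_shiftN C s R n), IHprv2; trivial.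
    intros x [<- | (y & <- & Hy)%in_map_iff]; [trivial | apply sat_shiftN; auto].
  - intros X HX; apply IHprv.
    + intros [|n]; simpl; auto.
    + intros q (x & <- & Hx)%in_map_iff; apply sat_shiftS; auto.
  - apply sat_instS, (IHprv s R HR HG), HR.
  - exists (R X); split; [apply HR | apply sat_instS; auto].
  - destruct (IHprv1 s R HR HG) as (X & HX & Hn).
    apply (sat_shiftS C s R X), IHprv2.
    + intros [|n]; simpl; auto.
    + intros x [<- | (y & <- & Hy)%in_map_iff]; [trivial | apply sat_shiftS; auto].
  - reflexivity.
  - apply sat_instN; rewrite <- (IHprv1 s R HR HG); apply sat_instN; auto.
Qed.

(** * Binary strings in the in-order *)

(** In-order: a node comes after its left subtree ([false]) and before its right subtree
    ([true]). *)
Fixpoint before (l m : list bool) : bool :=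
  match l, m with
  | [], [] => false
  | [], c :: _ => c
  | b :: _, [] => negb b
  | b :: l, c :: m => if eqb b c then before l m else c
  end.

Lemma before_irrefl l : before l l = false.
Proof. induction l as [|[] l IH]; simpl; auto. Qed.

Lemma before_trans l m k : before l m = true -> before m k = true -> before l k = true.
Proof.
  revert m k; induction l as [|[] l IH]; intros [|[] m] [|[] k]; simpl; try easy; apply IH.
Qed.

Lemma before_total l m : before l m = true \/ l = m \/ before m l = true.
Proof.
  revert m; induction l as [|[] l IH]; intros [|[] m]; simpl; auto;
    destruct (IH m) as [H | [-> | H]]; auto.
Qed.

(** The comparison with [l] reads [m] at most up to the bit at position [length l], which the strict
    inequality keeps inside the prefix. *)
Lemma before_firstn_r n l m :
  length l < n -> before l (firstn n m) = before l m.
Proof.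
  revert l m; induction n as [|n IH]; intros [|[] l] [|[] m]; simpl; try easy;
    intros H; apply IH; lia.
Qed.

Lemma before_firstn_l n l m :
  length l < n -> before (firstn n m) l = before m l.
Proof.
  revert l m; induction n as [|n IH]; intros [|[] l] [|[] m]; simpl; try easy;
    intros H; apply IH; lia.
Qed.

(** The path that turns right exactly at the nodes in [C]; when [C] is the lower part of a cut, this
    path follows the cut. *)
Fixpoint along (C : list bool -> Prop) (l : list bool) : Prop :=
  match l with
  | [] => True
  | b :: l => (b = true <-> C []) /\ along (fun m => C (b :: m)) l
  end.

Lemma along_exists C n : exists l, length l = n /\ along C l.
Proof.
  revert C; induction n as [|n IH]; intros C; [now exists []|].
  assert (exists b : bool, b = true <-> C []) as [b Hb].
  { destruct (classic (C [])); [exists true | exists false]; intuition easy. }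
  destruct (IH (fun m => C (b :: m))) as (l & Hl & H).
  exists (b :: l); simpl; auto.
Qed.

Lemma along_unique C l m : length l = length m -> along C l -> along C m -> l = m.
Proof.
  revert C m; induction l as [|b l IH]; intros C [|c m]; simpl; try easy.
  intros E [Hb Hl] [Hc Hm].
  assert (b = c) as <- by (destruct b, c; intuition congruence).
  f_equal; eapply IH; eauto; lia.
Qed.

Lemma along_firstn C n l : along C l -> along C (firstn n l).
Proof.
  revert C l; induction n as [|n IH]; intros C [|b l]; simpl; auto.
  intros [Hb Hl]; auto.
Qed.

Lemma along_nth C l :
  along C l <-> forall i, i < length l -> (nth i l false = true <-> C (firstn i l)).
Proof.
  revert C; induction l as [|b l IH]; intros C; simpl; [split; [intros _ i; lia | trivial]|].
  rewrite IH; split.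
  - intros [Hb Hl] [|i] Hi; simpl; [trivial | apply Hl; lia].
  - intros H; split; [apply (H 0); lia | intros i Hi; apply (H (S i)); lia].
Qed.

(** Here [i] is the first level at which [y] leaves [l]; there [y] turns to the side opposite to the
    one prescribed by [C]. *)
Lemma along_diverge C l y :
  along C l -> length l <= length y ->
  firstn (length l) y = l \/
  exists i, i < length l /\
    (C (firstn i y) /\ before y (firstn i y) = true \/
     ~ C (firstn i y) /\ before (firstn i y) y = true).
Proof.
  revert C y; induction l as [|b l IH]; intros C y Hl Hy; [now left|].
  destruct y as [|c y]; simpl in Hy; [lia|]; destruct Hl as [Hb Hl].
  destruct (bool_dec b c) as [<- | N].
  - destruct (IH (fun m => C (b :: m)) y Hl) as [E | (i & Hi & H)]; [lia | |].
    + left; simpl; now rewrite E.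
    + right; exists (S i); split; [simpl; lia|].
      simpl; now rewrite eqb_reflx.
  - right; exists 0; split; [simpl; lia|]; simpl.
    destruct b, c; try easy; [left | right]; intuition congruence.
Qed.

(* A cut without endpoints restricts to a cut without endpoints of the subtree
   on the side of the cut, so that following the cut never leaves the tree. *)
Lemma along_gap l : forall A B : list bool -> Prop,
  A [] \/ B [] ->
  (forall b m, A (b :: m) \/ B (b :: m) -> forall k, A (firstn k (b :: m)) \/ B (firstn k (b :: m))) ->
  (forall x y, A x -> B y -> before x y = true) ->
  (forall m, A m -> exists x, A x /\ before m x = true) ->
  (forall m, B m -> exists x, B x /\ before x m = true) ->
  along A l -> A l \/ B l.
Proof.
  induction l as [|b l IH]; intros A B H0 Hpre Hlt Hmax Hmin Hl; trivial.
  destruct Hl as [Hb Hl].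
  apply (IH (fun m => A (b :: m)) (fun m => B (b :: m))); trivial.
  (* The child chosen by [b] is in the tree: the root is not an endpoint of its piece, so some
     element lies in that child's subtree, and the child is a prefix of it. *)
  - destruct b.
    + destruct (Hmax []) as ([|[] x] & Hx & E); [tauto | easy | | easy].
      exact (Hpre true x (or_introl Hx) 1).
    + assert (B []) as HB by (destruct H0 as [H0 | H0]; [apply Hb in H0; easy | trivial]).
      destruct (Hmin [] HB) as ([|[] x] & Hx & E); [easy | easy |].
      exact (Hpre false x (or_intror Hx) 1).
  - intros c m H k; exact (Hpre b (c :: m) H (S k)).
  - intros x y Hx Hy; specialize (Hlt _ _ Hx Hy); simpl in Hlt; now rewrite eqb_reflx in Hlt.
  (* The larger element stays in the same subtree: for [b] false the root is in [B], so all of [A]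
     lies in the left subtree. *)
  - intros m Hm; destruct (Hmax _ Hm) as (x & Hx & E).
    destruct b, x as [|[] x]; try easy; eauto.
    + specialize (proj2 Hb Hx); easy.
    + assert (B []) as HB.
      { destruct H0 as [H0 | H0]; [apply Hb in H0; easy | trivial]. }
      now specialize (Hlt _ _ Hx HB).
  - intros m Hm; destruct (Hmin _ Hm) as (x & Hx & E).
    destruct b, x as [|[] x]; try easy; eauto.
    + now specialize (Hlt _ _ (proj1 Hb eq_refl) Hx).
    + now specialize (Hlt _ _ (proj1 Hb eq_refl) Hx).
Qed.

(** * Numbers as codes of binary strings *)

Fixpoint code (l : list bool) : nat :=
  match l with
  | [] => 0
  | b :: l => 2 * code l + (if b then 2 else 1)
  end.

(** Inverts [code], which is bijective base 2 with digits 1 and 2, lowest digit first; every number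
    thus codes exactly one string. The argument [k] is fuel, and [n] units suffice. *)
Fixpoint decode (k n : nat) : list bool :=
  match k, n with
  | S k, S m => Nat.odd m :: decode k (Nat.div2 m)
  | _, _ => []
  end.

Definition node (n : nat) : list bool := decode n n.

Lemma code_decode k : forall n, n <= k -> code (decode k n) = n.
Proof.
  induction k as [|k IH]; intros [|m] H; simpl; try lia.
  pose proof (Nat.div2_odd m) as E; pose proof (Nat.div2_decr m m).
  rewrite IH by lia; destruct (Nat.odd m); simpl in *; lia.
Qed.

Lemma code_node n : code (node n) = n.
Proof. now apply code_decode. Qed.

Lemma code_inj l m : code l = code m -> l = m.
Proof.
  revert m; induction l as [|[] l IH]; intros [|[] m]; simpl; intros E; try lia; trivial;
    f_equal; apply IH; lia.
Qed.

Lemma node_code l : node (code l) = l.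
Proof. apply code_inj, code_node. Qed.

Lemma length_le_code l : length l <= code l.
Proof. induction l as [|[] l IH]; simpl; lia. Qed.

Lemma length_node n : length (node n) <= n.
Proof. rewrite <- (code_node n) at 2; apply length_le_code. Qed.

Lemma code_lt_pow l : code l + 2 <= 2 ^ S (length l).
Proof. induction l as [|[] l IH]; simpl in *; lia. Qed.

(** * Pairs and finite sets inside arithmetic *)

Definition np (x y : nat) : nat := (x + y) * (x + y) + x.
Definition np1 (z : nat) : nat := z - Nat.sqrt z * Nat.sqrt z.
Definition np2 (z : nat) : nat := Nat.sqrt z - np1 z.

(** The summand x is at most 2 (x + y), so the pair lies below the next square. *)
Lemma sqrt_np x y : Nat.sqrt (np x y) = x + y.
Proof. apply Nat.sqrt_unique; unfold np; nia. Qed.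

Lemma np1_np x y : np1 (np x y) = x.
Proof. unfold np1; rewrite sqrt_np; unfold np; lia. Qed.

Lemma np2_np x y : np2 (np x y) = y.
Proof. unfold np2; rewrite np1_np, sqrt_np; lia. Qed.

Lemma np_inj x y x' y' : np x y = np x' y' -> x = x' /\ y = y'.
Proof.
  intros E; split.
  - now rewrite <- (np1_np x y), E, np1_np.
  - now rewrite <- (np2_np x y), E, np2_np.
Qed.

Lemma np_le_l x y : x <= np x y.
Proof. unfold np; lia. Qed.

Definition fin_in (x c : nat) : Prop :=
  exists k m n, c = np k (np m n) /\ x < k /\ exists q, n = (m * (x + 1) + 1) * q.

Lemma fin_in_lt x c : fin_in x c -> x < c.
Proof. intros (k & m & n & -> & H & _); pose proof (np_le_l k (np m n)); lia. Qed.

Lemma divide_fact a k : 0 < a <= k -> Nat.divide a (fact k).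
Proof.
  induction k as [|k IH]; [lia|]; intros H.
  destruct (Nat.eq_dec a (S k)) as [-> | N].
  - apply Nat.divide_factor_l.
  - apply Nat.divide_mul_r, IH; lia.
Qed.

(** A common divisor divides a combination of the two numbers equal to [y - x], hence divides
    [fact k], and hence divides 1. *)
Lemma beta_coprime k x y :
  x < y -> y < k ->
  Nat.gcd (fact k * (x + 1) + 1) (fact k * (y + 1) + 1) = 1.
Proof.
  intros Hxy Hy; set (m := fact k).
  set (g := Nat.gcd _ _).
  assert (Nat.divide g (m * (x + 1) + 1)) as Ha by apply Nat.gcd_divide_l.
  assert (Nat.divide g (m * (y + 1) + 1)) as Hb by apply Nat.gcd_divide_r.
  assert (Nat.divide g (y - x)) as Hd.
  { replace (y - x) with
      ((y + 1) * (m * (x + 1) + 1) - (x + 1) * (m * (y + 1) + 1)) by nia.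
    apply Nat.divide_sub_r; now apply Nat.divide_mul_r. }
  assert (Nat.divide g m) as Hm.
  { eapply Nat.divide_trans; [exact Hd | apply divide_fact; lia]. }
  apply Nat.divide_1_r.
  replace 1 with (m * (x + 1) + 1 - m * (x + 1)) by lia.
  apply Nat.divide_sub_r; [exact Ha | now apply Nat.divide_mul_l].
Qed.

(** Gödel's β-function: the second component is the product of the moduli [d x] over the [x < k] in
    [P], and coprimality prevents any other modulus from dividing it. *)
Lemma fin_in_exists (P : nat -> Prop) k : exists c, forall x, fin_in x c <-> x < k /\ P x.
Proof.
  set (d x := fact k * (x + 1) + 1).
  assert (forall j, j <= k -> exists n,
    n <> 0 /\ forall x, x < k -> (Nat.divide (d x) n <-> x < j /\ P x)) as H.
  { induction j as [|j IH]; intros Hj.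
    - exists 1; split; [easy|]; intros x Hx; split; [|lia].
      intros E%Nat.divide_1_r; unfold d in E; pose proof (lt_O_fact k); nia.
    - destruct IH as (n & Hn & IH); [lia|].
      destruct (classic (P j)) as [HP | HP].
      + exists (d j * n); split; [unfold d; nia|]; intros x Hx.
        destruct (Nat.eq_dec x j) as [-> | N].
        * split; [intros _; split; [lia | trivial] | intros _; apply Nat.divide_factor_l].
        * transitivity (Nat.divide (d x) n).
          -- split; [|intros; now apply Nat.divide_mul_r].
             intros E; apply (Nat.gauss _ _ _ E).
             destruct (Nat.lt_ge_cases x j); [apply beta_coprime; lia|].
             rewrite Nat.gcd_comm; apply beta_coprime; lia.
          -- rewrite IH by lia; intuition lia.
      + exists n; split; [trivial|]; intros x Hx; rewrite IH by lia.
        split; [intuition lia|]; intros [H HPx]; split; [|trivial].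
        destruct (Nat.eq_dec x j) as [-> | N]; [tauto | lia]. }
  destruct (H k) as (n & _ & Hn); [lia|].
  exists (np k (np (fact k) n)); intros x; split.
  - intros (k' & m & n' & E & Hx & q & Hq).
    apply np_inj in E as [<- E]; apply np_inj in E as [<- <-].
    split; [trivial|]; apply Hn; [trivial|]; exists q; rewrite Hq; unfold d; lia.
  - intros [Hx HP]; exists k, (fact k), n; repeat split; trivial.
    destruct (proj2 (Hn x Hx) (conj Hx HP)) as [q Hq]; exists q; rewrite Hq; unfold d; lia.
Qed.

(** * Computability with a reflecting oracle *)

Definition pi1 (z : nat) : nat := fst (Cantor.of_nat z).
Definition pi2 (z : nat) : nat := snd (Cantor.of_nat z).
Definition cp (x y : nat) : nat := Cantor.to_nat (x, y).

Lemma pi1_cp x y : pi1 (cp x y) = x.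
Proof. unfold pi1, cp; now rewrite Cantor.cancel_of_to. Qed.

Lemma pi2_cp x y : pi2 (cp x y) = y.
Proof. unfold pi2, cp; now rewrite Cantor.cancel_of_to. Qed.

Lemma pi2_le z : pi2 z <= z.
Proof.
  unfold pi2; rewrite <- (Cantor.cancel_to_of z) at 2.
  destruct (Cantor.of_nat z) as [x y]; pose proof (Cantor.to_nat_non_decreasing x y); simpl; lia.
Qed.

(** Arithmetic, pairing and string operations are primitive, which spares programming them; every
    index from 13 on is the in-order comparison. *)
Definition prim (i x : nat) : nat :=
  match i with
  | 0 => x
  | 1 => pi1 x
  | 2 => pi2 x
  | 3 => pi1 x + pi2 x
  | 4 => pi1 x * pi2 x
  | 5 => pi1 x - pi2 x
  | 6 => if pi1 x <? pi2 x then 1 else 0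
  | 7 => np1 x
  | 8 => np2 x
  | 9 => 2 ^ x
  | 10 => length (node x)
  | 11 => code (firstn (pi1 x) (node (pi2 x)))
  | 12 => if nth (pi1 x) (node (pi2 x)) false then 1 else 0
  | _ => if before (node (pi1 x)) (node (pi2 x)) then 1 else 0
  end.

Fixpoint search (g : nat -> option nat) (k y : nat) : option nat :=
  match k with
  | 0 => None
  | S k =>
      match g y with
      | Some 0 => search g k (S y)
      | Some (S _) => Some y
      | None => None
      end
  end.

(* [n] bounds the nesting of calls, the length of searches and the oracle queries. *)
Fixpoint run (o : nat -> nat) (n c x : nat) : option nat :=
  match n with
  | 0 => None
  | S n =>
      let p := pi2 c in
      match pi1 c with
      | 0 => Some p
      | 1 => Some (prim p x)
      | 2 => if x <? n then Some (o x) else None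
      | 3 => match run o n (pi2 p) x with Some y => run o n (pi1 p) y | None => None end
      | 4 =>
          match run o n (pi1 p) x, run o n (pi2 p) x with
          | Some y, Some z => Some (cp y z)
          | _, _ => None
          end
      | _ => search (fun y => run o n p (cp x y)) n 0
      end
  end.

Lemma search_mono g h k k' y v :
  (forall z w, g z = Some w -> h z = Some w) -> k <= k' ->
  search g k y = Some v -> search h k' y = Some v.
Proof.
  intros Hgh; revert k' y; induction k as [|k IH]; intros [|k'] y Hk; simpl; try easy.
  destruct (g y) as [[|w]|] eqn:E; [| | easy]; rewrite (Hgh _ _ E); trivial.
  apply IH; lia.
Qed.

Lemma search_ext g h k y : (forall z, g z = h z) -> search g k y = search h k y.
Proof.
  intros H; revert y; induction k as [|k IH]; intros y; simpl; trivial.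
  now rewrite H, IH.
Qed.

Lemma search_find g k y v w :
  y <= v -> v - y < k -> (forall z, y <= z < v -> g z = Some 0) -> g v = Some (S w) ->
  search g k y = Some v.
Proof.
  revert y; induction k as [|k IH]; intros y Hy Hk H0 Hv; [lia|]; simpl.
  destruct (Nat.eq_dec y v) as [-> | N]; [now rewrite Hv|].
  rewrite H0 by lia; apply IH; try lia; trivial; intros z Hz; apply H0; lia.
Qed.

Lemma run_mono o n m c x v : run o n c x = Some v -> n <= m -> run o m c x = Some v.
Proof.
  revert m c x v; induction n as [|n IH]; intros [|m] c x v; simpl; try easy.
  intros H Hnm; apply le_S_n in Hnm.
  destruct (pi1 c) as [|[|[|[|[|t]]]]]; trivial.
  - destruct (Nat.ltb_spec x n); [|easy]; now rewrite (proj2 (Nat.ltb_lt x m)) by lia.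
  - destruct (run o n (pi2 (pi2 c)) x) as [y|] eqn:E; [|easy].
    rewrite (IH _ _ _ _ E Hnm); eauto.
  - destruct (run o n (pi1 (pi2 c)) x) as [y|] eqn:E; [|easy].
    destruct (run o n (pi2 (pi2 c)) x) as [z|] eqn:E'; [|easy].
    now rewrite (IH _ _ _ _ E Hnm), (IH _ _ _ _ E' Hnm).
  - revert H; apply search_mono; eauto.
Qed.

(** Queries are answered only below the bound; this makes an oracle about its own programs
    well-founded. *)
Lemma run_oracle_ext o o' n c x :
  (forall z, z < n -> o z = o' z) -> run o n c x = run o' n c x.
Proof.
  revert c x; induction n as [|n IH]; intros c x H; simpl; trivial.
  assert (forall c x, run o n c x = run o' n c x) as IH' by (intros; apply IH; auto).
  destruct (pi1 c) as [|[|[|[|[|t]]]]]; trivial.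
  - destruct (Nat.ltb_spec x n); [|trivial]; now rewrite H by lia.
  - rewrite IH'; destruct (run o' n (pi2 (pi2 c)) x); auto.
  - now rewrite !IH'.
  - apply search_ext; auto.
Qed.

(** * The reflecting oracle *)

Definition reflect_step (o : nat -> nat) (z : nat) : nat :=
  match run o (pi2 z) (pi1 z) (pi1 z) with Some v => S v | None => 0 end.

(** Course-of-values recursion: the value at [z] is computed with bound [pi2 z], which is at most
    [z], so only earlier values are consulted. *)
Fixpoint oracle_below (n : nat) : nat -> nat :=
  match n with
  | 0 => fun _ => 0
  | S n => fun z => if z <? n then oracle_below n z else reflect_step (oracle_below n) z
  end.

Definition oracle (z : nat) : nat := oracle_below (S z) z.

Lemma oracle_below_eq n z : z < n -> oracle_below n z = oracle z.
Proof.
  induction n as [|n IH]; [lia|]; intros Hz; simpl.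
  destruct (Nat.ltb_spec z n) as [L | L]; [auto|].
  assert (z = n) as -> by lia.
  unfold oracle; simpl; now rewrite Nat.ltb_irrefl.
Qed.

(* The oracle answers step-bounded halting questions about programs that query
   the oracle itself; this spares an interpreter written as a program. *)
Lemma oracle_eq e s :
  oracle (cp e s) = match run oracle s e e with Some v => S v | None => 0 end.
Proof.
  unfold oracle at 1; simpl; rewrite Nat.ltb_irrefl.
  unfold reflect_step; rewrite pi1_cp, pi2_cp.
  rewrite (run_oracle_ext _ oracle); trivial.
  intros z Hz; apply oracle_below_eq.
  pose proof (pi2_le (cp e s)) as H; rewrite pi2_cp in H; lia.
Qed.

(** * Computable functions and decidable predicates *)

Definition comp (f : nat -> nat) : Prop :=
  exists c, forall x, exists n, run oracle n c x = Some (f x).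

Definition dec (P : nat -> Prop) : Prop :=
  exists f, comp f /\ forall x, P x <-> f x <> 0.

Lemma comp_ext f g : (forall x, f x = g x) -> comp f -> comp g.
Proof. intros E [c H]; exists c; intros x; rewrite <- E; apply H. Qed.

Lemma dec_ext P Q : (forall x, P x <-> Q x) -> dec P -> dec Q.
Proof. intros E (f & Hf & H); exists f; split; [trivial|]; intros x; now rewrite <- E. Qed.

Lemma comp_const k : comp (fun _ => k).
Proof. exists (cp 0 k); intros x; exists 1; simpl; now rewrite pi1_cp, pi2_cp. Qed.

Lemma comp_prim1 i : comp (prim i).
Proof. exists (cp 1 i); intros x; exists 1; simpl; now rewrite pi1_cp, pi2_cp. Qed.

Lemma comp_oracle1 : comp oracle.
Proof.
  exists (cp 2 0); intros x; exists (S (S x)); cbn [run]; rewrite pi1_cp.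
  now rewrite (proj2 (Nat.ltb_lt x (S x))) by lia.
Qed.

Lemma comp_app f g : comp f -> comp g -> comp (fun x => f (g x)).
Proof.
  intros [a Ha] [b Hb]; exists (cp 3 (cp a b)); intros x.
  destruct (Hb x) as [n Hn], (Ha (g x)) as [m Hm].
  exists (S (max n m)); simpl; rewrite !pi1_cp, !pi2_cp, pi1_cp.
  rewrite (run_mono _ _ (max n m) _ _ _ Hn) by lia; apply (run_mono _ _ _ _ _ _ Hm); lia.
Qed.

Lemma comp_cp f g : comp f -> comp g -> comp (fun x => cp (f x) (g x)).
Proof.
  intros [a Ha] [b Hb]; exists (cp 4 (cp a b)); intros x.
  destruct (Ha x) as [n Hn], (Hb x) as [m Hm].
  exists (S (max n m)); simpl; rewrite !pi1_cp, !pi2_cp, pi1_cp.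
  now rewrite (run_mono _ _ (max n m) _ _ _ Hn), (run_mono _ _ (max n m) _ _ _ Hm) by lia.
Qed.

Lemma comp_prim i f : comp f -> comp (fun x => prim i (f x)).
Proof. apply comp_app, comp_prim1. Qed.

Lemma comp_prim_cp i f g : comp f -> comp g -> comp (fun x => prim i (cp (f x) (g x))).
Proof. intros; now apply comp_prim, comp_cp. Qed.

Lemma comp_id : comp (fun x => x).
Proof. exact (comp_prim1 0). Qed.

Lemma comp_pi1 f : comp f -> comp (fun x => pi1 (f x)).
Proof. exact (comp_prim 1 f). Qed.

Lemma comp_pi2 f : comp f -> comp (fun x => pi2 (f x)).
Proof. exact (comp_prim 2 f). Qed.

Lemma comp_np1 f : comp f -> comp (fun x => np1 (f x)).
Proof. exact (comp_prim 7 f). Qed.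

Lemma comp_np2 f : comp f -> comp (fun x => np2 (f x)).
Proof. exact (comp_prim 8 f). Qed.

Lemma comp_pow f : comp f -> comp (fun x => 2 ^ f x).
Proof. exact (comp_prim 9 f). Qed.

Lemma comp_length f : comp f -> comp (fun x => length (node (f x))).
Proof. exact (comp_prim 10 f). Qed.

Lemma comp_oracle f : comp f -> comp (fun x => oracle (f x)).
Proof. apply comp_app, comp_oracle1. Qed.

Ltac from_prim i :=
  intros Hf Hg; refine (comp_ext _ _ _ (comp_prim_cp i _ _ Hf Hg));
  intros x; simpl; now rewrite pi1_cp, pi2_cp.

Lemma comp_add f g : comp f -> comp g -> comp (fun x => f x + g x).
Proof. from_prim 3. Qed.

Lemma comp_mul f g : comp f -> comp g -> comp (fun x => f x * g x).
Proof. from_prim 4. Qed.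

Lemma comp_sub f g : comp f -> comp g -> comp (fun x => f x - g x).
Proof. from_prim 5. Qed.

Lemma comp_firstn f g :
  comp f -> comp g -> comp (fun x => code (firstn (f x) (node (g x)))).
Proof. from_prim 11. Qed.

Lemma comp_succ f : comp f -> comp (fun x => S (f x)).
Proof.
  intros H; refine (comp_ext (fun x => f x + 1) _ _ _); [intros; lia|].
  apply comp_add; [trivial | apply comp_const].
Qed.

Lemma comp_np f g : comp f -> comp g -> comp (fun x => np (f x) (g x)).
Proof. intros Hf Hg; unfold np; repeat apply comp_add || apply comp_mul; trivial. Qed.

Lemma dec_lt f g : comp f -> comp g -> dec (fun x => f x < g x).
Proof.
  intros Hf Hg; eexists; split; [exact (comp_prim_cp 6 _ _ Hf Hg)|].
  intros x; simpl; rewrite pi1_cp, pi2_cp; destruct (Nat.ltb_spec (f x) (g x)); lia.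
Qed.

Lemma dec_bit f g : comp f -> comp g -> dec (fun x => nth (f x) (node (g x)) false = true).
Proof.
  intros Hf Hg; eexists; split; [exact (comp_prim_cp 12 _ _ Hf Hg)|].
  intros x; simpl; rewrite pi1_cp, pi2_cp; destruct (nth _ _ _); easy.
Qed.

Lemma dec_before f g :
  comp f -> comp g -> dec (fun x => before (node (f x)) (node (g x)) = true).
Proof.
  intros Hf Hg; eexists; split; [exact (comp_prim_cp 13 _ _ Hf Hg)|].
  intros x; simpl; rewrite pi1_cp, pi2_cp; destruct (before _ _); easy.
Qed.

Lemma dec_app P f : dec P -> comp f -> dec (fun x => P (f x)).
Proof.
  intros (g & Hg & H) Hf; exists (fun x => g (f x)); split; [now apply comp_app | auto].
Qed.

Lemma dec_and P Q : dec P -> dec Q -> dec (fun x => P x /\ Q x).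
Proof.
  intros (f & Hf & Ef) (g & Hg & Eg); exists (fun x => f x * g x); split;
    [now apply comp_mul|]; intros x; rewrite Ef, Eg; nia.
Qed.

Lemma dec_or P Q : dec P -> dec Q -> dec (fun x => P x \/ Q x).
Proof.
  intros (f & Hf & Ef) (g & Hg & Eg); exists (fun x => f x + g x); split;
    [now apply comp_add|]; intros x; rewrite Ef, Eg; lia.
Qed.

Lemma dec_not P : dec P -> dec (fun x => ~ P x).
Proof.
  intros (f & Hf & Ef); exists (fun x => 1 - f x); split;
    [apply comp_sub; [apply comp_const | trivial]|]; intros x; rewrite Ef; lia.
Qed.

Lemma dec_imp P Q : dec P -> dec Q -> dec (fun x => P x -> Q x).
Proof.
  intros HP HQ; refine (dec_ext _ _ _ (dec_or _ _ (dec_not _ HP) HQ)).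
  intros x; destruct (classic (P x)); tauto.
Qed.

Lemma dec_iff P Q : dec P -> dec Q -> dec (fun x => P x <-> Q x).
Proof. intros; apply dec_and; now apply dec_imp. Qed.

Lemma dec_eq f g : comp f -> comp g -> dec (fun x => f x = g x).
Proof.
  intros Hf Hg.
  refine (dec_ext _ _ _ (dec_and _ _ (dec_not _ (dec_lt _ _ Hf Hg)) (dec_not _ (dec_lt _ _ Hg Hf)))).
  intros x; lia.
Qed.

Lemma run_bound c g x y :
  (forall z, exists n, run oracle n c z = Some (g z)) ->
  exists n, forall i, i < y -> run oracle n c (cp x i) = Some (g (cp x i)).
Proof.
  intros H; induction y as [|y [n Hn]]; [exists 0; intros i; lia|].
  destruct (H (cp x y)) as [m Hm]; exists (max n m); intros i Hi.
  destruct (Nat.eq_dec i y) as [-> | N].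
  - apply (run_mono _ _ _ _ _ _ Hm); lia.
  - apply (run_mono _ n); [apply Hn |]; lia.
Qed.

(** Unbounded minimization. Since [g] decides [P], mere existence of a witness yields the least one;
    the program with opcode 5 performs the same search. *)
Lemma comp_least (P : nat -> nat -> Prop) :
  dec (fun z => P (pi1 z) (pi2 z)) -> (forall x, exists y, P x y) ->
  exists f, comp f /\ forall x, P x (f x) /\ forall y, y < f x -> ~ P x y.
Proof.
  intros (g & [c Hc] & Hg) Hex.
  assert (forall x y, P x y <-> g (cp x y) <> 0) as E.
  { intros x y; rewrite <- Hg, pi1_cp, pi2_cp; reflexivity. }
  assert (forall x, {y | g (cp x y) <> 0 /\ forall z, g (cp x z) <> 0 -> y <= z}) as F.
  { intros x; apply (epsilon_smallest (fun y => g (cp x y) <> 0)).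
    - intros y; destruct (Nat.eq_dec (g (cp x y)) 0); auto.
    - destruct (Hex x) as [y Hy]; exists y; now apply E. }
  exists (fun x => proj1_sig (F x)); split.
  - exists (cp 5 c); intros x; destruct (F x) as (y & Hy & Hmin); simpl.
    (* All tests up to the least witness must converge under one common bound, which must also
       exceed the length of the search. *)
    destruct (run_bound c g x (S y) Hc) as [n Hn].
    set (N := max n (S y)).
    assert (forall i, i < S y -> run oracle N c (cp x i) = Some (g (cp x i))) as HN.
    { intros i Hi; apply (run_mono _ n); [auto | unfold N; lia]. }
    exists (S N); cbn [run]; rewrite pi1_cp, pi2_cp; cbv zeta.
    apply (search_find _ _ _ _ (pred (g (cp x y)))); [lia | unfold N; lia | |].
    + intros z Hz; rewrite HN by lia; f_equal.
      destruct (Nat.eq_dec (g (cp x z)) 0) as [e | e]; [trivial | apply Hmin in e; lia].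
    + rewrite HN by lia; f_equal; lia.
  - intros x; destruct (F x) as (y & Hy & Hmin); simpl; split; [now apply E|].
    intros z Hz Hn; apply E, Hmin in Hn; lia.
Qed.

(** Search for the least [y] that is a counterexample or reaches [t x]; the search always ends, and
    the statement holds iff it ends at [t x]. *)
Lemma dec_all_lt t (P : nat -> nat -> Prop) :
  comp t -> dec (fun z => P (pi1 z) (pi2 z)) -> dec (fun x => forall y, y < t x -> P x y).
Proof.
  intros Ht HP.
  destruct (comp_least (fun x y => ~ (y < t x /\ P x y))) as (f & Hf & H).
  - apply dec_not, dec_and; [|trivial].
    apply dec_lt; [apply comp_pi2, comp_id | apply comp_app; [trivial | apply comp_pi1, comp_id]].
  - intros x; exists (t x); lia.
  - refine (dec_ext _ _ _ (dec_not _ (dec_lt _ _ Hf Ht))).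
    intros x; destruct (H x) as [H1 H2]; split.
    + intros L y Hy; destruct (NNPP _ (H2 y ltac:(lia))); trivial.
    + intros Hall L; apply H1; auto.
Qed.

Lemma dec_ex_lt t (P : nat -> nat -> Prop) :
  comp t -> dec (fun z => P (pi1 z) (pi2 z)) -> dec (fun x => exists y, y < t x /\ P x y).
Proof.
  intros Ht HP; refine (dec_ext _ _ _ (dec_not _ (dec_all_lt t (fun x y => ~ P x y) Ht (dec_not _ HP)))).
  intros x; split.
  - intros H; apply NNPP; intros N; apply H; intros y Hy Hp; apply N; eauto.
  - intros (y & Hy & Hp) H; exact (H y Hy Hp).
Qed.

(** Applies the closure properties by the shape of the goal and leaves unrecognized goals open.
    Constants are tried before arithmetic. *)
Ltac dec :=
  cbv beta;
  lazymatch goal with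
  | H : dec ?P |- dec ?P => exact H
  | H : comp ?f |- comp ?f => exact H
  | |- comp (fun x => x) => exact comp_id
  | |- comp pi1 => exact (comp_prim1 1)
  | |- comp pi2 => exact (comp_prim1 2)
  | |- comp np1 => exact (comp_prim1 7)
  | |- comp np2 => exact (comp_prim1 8)
  | |- comp (fun _ => ?k) => exact (comp_const k)
  | |- comp (fun x => _ + _) => apply comp_add; dec
  | |- comp (fun x => _ * _) => apply comp_mul; dec
  | |- comp (fun x => _ - _) => apply comp_sub; dec
  | |- comp (fun x => S _) => apply comp_succ; dec
  | |- comp (fun x => 2 ^ _) => apply comp_pow; dec
  | |- comp (fun x => pi1 _) => apply comp_pi1; dec
  | |- comp (fun x => pi2 _) => apply comp_pi2; dec
  | |- comp (fun x => np1 _) => apply comp_np1; dec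
  | |- comp (fun x => np2 _) => apply comp_np2; dec
  | |- comp (fun x => np _ _) => apply comp_np; dec
  | |- comp (fun x => cp _ _) => apply comp_cp; dec
  | |- comp (fun x => oracle _) => apply comp_oracle; dec
  | |- comp (fun x => length (node _)) => apply comp_length; dec
  | |- comp (fun x => code (firstn _ (node _))) => apply comp_firstn; dec
  | H : comp ?f |- comp (fun x => ?f (@?g x)) => apply (comp_app f g H); dec
  | |- dec (fun x => _ < _) => apply dec_lt; dec
  | |- dec (fun x => nth _ (node _) false = true) => apply dec_bit; dec
  | |- dec (fun x => before (node _) (node _) = true) => apply dec_before; dec
  | |- dec (fun x => @eq nat _ _) => apply dec_eq; dec
  | |- dec (fun x => _ /\ _) => apply dec_and; dec
  | |- dec (fun x => _ \/ _) => apply dec_or; dec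
  | |- dec (fun x => ~ _) => apply dec_not; dec
  | |- dec (fun x => _ <-> _) => apply dec_iff; dec
  | H : dec ?P |- dec (fun x => ?P (@?f x)) => apply (dec_app P f H); dec
  | |- dec (fun x => forall y, y < @?t x -> @?P x y) => apply (dec_all_lt t P); dec
  | |- dec (fun x => exists y, y < @?t x /\ @?P x y) => apply (dec_ex_lt t P); dec
  | |- dec (fun x => _ -> _) => apply dec_imp; dec
  | |- _ => idtac
  end.

(** * The model of decidable sets *)

Lemma comp_teval (d : nat -> nat -> nat) t :
  (forall n, comp (d n)) -> comp (fun x => teval (fun n => d n x) t).
Proof.
  intros H; induction t; simpl; dec.
  apply H.
Qed.

(** The number variables are computable functions of a parameter [x], so that the induction can pass
    under bounded quantifiers. *)
Lemma dec_Delta00 C p : Delta00 p -> forall (d : nat -> nat -> nat) R,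
  (forall n, comp (d n)) -> (forall n, dec (R n)) ->
  dec (fun x => sat C (fun n => d n x) R p).
Proof.
  (* Under a quantifier the new parameter is a pair of the old parameter and the bound variable. *)
  assert (forall (d : nat -> nat -> nat) R p, (forall n, comp (d n)) ->
    (forall d', (forall n, comp (d' n)) -> dec (fun x => sat C (fun n => d' n x) R p)) ->
    dec (fun z => sat C (scons (pi2 z) (fun n => d n (pi1 z))) R p)) as Hq.
  { intros d R q Hd IH.
    refine (dec_ext _ _ _ (IH (scons pi2 (fun n z => d n (pi1 z))) _)).
    - intros z; replace (scons (pi2 z) (fun n => d n (pi1 z))) with
        (fun n => scons pi2 (fun n z => d n (pi1 z)) n z); [reflexivity|].
      extensionality n; now destruct n.
    - intros [|n]; [exact (comp_prim1 2) | apply (comp_app (d n)); [apply Hd | exact (comp_prim1 1)]]. }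
  intros Hp; induction Hp; intros d R Hd HR; simpl.
  - apply (dec_ext (fun x => x < 0)); [lia | dec].
  - apply dec_eq; now apply comp_teval.
  - apply dec_lt; now apply comp_teval.
  - apply dec_app; [trivial | now apply comp_teval].
  - apply dec_and; auto.
  - apply dec_or; auto.
  - apply dec_imp; auto.
  - apply (dec_ext (fun x => forall y, y < teval (fun n => d n x) t ->
      sat C (scons y (fun n => d n x)) R p)).
    + intros x; split; intros H y Hy; apply H; rewrite ?teval_shift in *; trivial.
    + apply (dec_all_lt _ (fun x y => sat C (scons y (fun n => d n x)) R p));
        [now apply comp_teval | auto].
  - apply (dec_ext (fun x => exists y, y < teval (fun n => d n x) t /\
      sat C (scons y (fun n => d n x)) R p)).
    + intros x; split; intros (y & Hy & H); exists y; rewrite ?teval_shift in *; auto.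
    + apply (dec_ex_lt _ (fun x y => sat C (scons y (fun n => d n x)) R p));
        [now apply comp_teval | auto].
Qed.

Lemma dec_Delta00_2 C p s R :
  Delta00 p -> (forall n, dec (R n)) ->
  dec (fun z => sat C (scons (pi2 z) (scons (pi1 z) s)) R p).
Proof.
  intros Hp HR.
  refine (dec_ext _ _ _ (dec_Delta00 C p Hp
    (scons pi2 (scons pi1 (fun n _ => s n))) R _ HR)).
  - intros z; replace (scons (pi2 z) (scons (pi1 z) s)) with
      (fun n => scons pi2 (scons pi1 (fun n _ => s n)) n z); [reflexivity|].
    extensionality n; destruct n as [|[|n]]; reflexivity.
  - intros [|[|n]]; [exact (comp_prim1 2) | exact (comp_prim1 1) | exact (comp_const (s n))].
Qed.

(** Post's theorem: search for a witness of [P] or a counterexample to [Q]. One of them exists, and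
    the equivalence excludes having both. *)
Lemma dec_Delta01 (P Q : nat -> nat -> Prop) :
  dec (fun z => P (pi1 z) (pi2 z)) -> dec (fun z => Q (pi1 z) (pi2 z)) ->
  (forall x, (exists y, P x y) <-> (forall y, Q x y)) ->
  dec (fun x => exists y, P x y).
Proof.
  intros HP HQ E.
  destruct (comp_least (fun x y => P x y \/ ~ Q x y)) as (f & Hf & H).
  - apply dec_or; [|apply dec_not]; trivial.
  - intros x; destruct (classic (exists y, P x y)) as [[y Hy] | N]; [eauto|].
    rewrite E in N; apply not_all_ex_not in N as [y Hy]; eauto.
  - apply (dec_ext (fun x => P x (f x))).
    + intros x; split; [eauto|]; intros Hx.
      destruct (H x) as [[H1 | H1] _]; [trivial|]; destruct H1; now apply E.
    + refine (dec_ext _ _ _ (dec_app _ (fun x => cp x (f x)) HP _)); [|dec].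
      intros x; rewrite pi1_cp, pi2_cp; reflexivity.
Qed.

Lemma RCA0_sat q s R : RCA0 q -> (forall n, dec (R n)) -> sat dec s R q.
Proof.
  intros Hq HR; destruct Hq as [q Hq | p Hp | p q [p' Hp] [q' Hq]].
  - destruct Hq; cbn; intros; try lia.
  - unfold induction_for; cbn [sat]; rewrite sat_instN; intros H0 HS n.
    induction n as [|n IH]; [exact H0|].
    specialize (HS n IH); rewrite sat_subst in HS.
    replace (scons (S n) s) with
      (fun k => teval (scons n s) (scons (Plus (Var 0) One) (fun n => Var (S n)) k));
      [exact HS|].
    extensionality k; destruct k; simpl; lia.
  - unfold comprehension_for; cbn [sat]; intros E.
    exists (fun n => exists y, sat dec (scons y (scons n s)) R p'); split.
    + apply (dec_Delta01 _ (fun n y => sat dec (scons y (scons n s)) R q')).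
      * now apply dec_Delta00_2.
      * now apply dec_Delta00_2.
      * exact E.
    + intros n; unfold Iff; cbn [sat]; rewrite sat_shiftS; simpl; tauto.
Qed.

(** * The Kleene tree *)

(** Programs run for [length l] steps only, which makes the tree decidable; longer strings see more
    outputs, so it is closed under prefixes. *)
Definition tree (l : list bool) : Prop :=
  forall e, e < length l ->
  forall v, run oracle (length l) e e = Some v -> v <> code (firstn (S e) l).

Lemma tree_firstn n l : tree l -> tree (firstn n l).
Proof.
  intros H e He v Hv; rewrite length_firstn in *.
  rewrite firstn_firstn, Nat.min_l by lia.
  apply H; [lia|]; apply (run_mono _ _ _ _ _ _ Hv); lia.
Qed.

(** The step-bounded run of program [e] on input [e] is a single oracle query. *)
Lemma dec_tree : dec (fun x => tree (node x)).
Proof.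
  apply (dec_ext (fun x => forall e, e < length (node x) ->
    ~ oracle (cp e (length (node x))) = S (code (firstn (S e) (node x))))); [|dec].
  intros x; split; intros H e He; specialize (H e He).
  - intros v Hv E; apply H; now rewrite oracle_eq, Hv, E.
  - rewrite oracle_eq; destruct (run oracle (length (node x)) e e) as [v|]; [|easy].
    intros [= E]; exact (H v eq_refl E).
Qed.

(** Program [e] excludes at most one string of length [e + 1], so one of the two choices of the bit
    at position [e] is always free. *)
Lemma tree_infinite n : exists l, length l = n /\ tree l.
Proof.
  (* The step bound stays at the final length [n] while the string grows. *)
  assert (forall k, exists l, length l = k /\ forall e, e < k ->
    forall v, run oracle n e e = Some v -> v <> code (firstn (S e) l)) as H.
  { induction k as [|k (l & Hl & IH)]; [exists []; split; [trivial | lia]|].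
    assert (exists b, forall v, run oracle n k k = Some v -> v <> code (l ++ [b])) as [b Hb].
    { destruct (run oracle n k k) as [v|]; [|exists true; easy].
      destruct (Nat.eq_dec v (code (l ++ [true]))) as [-> | N].
      - exists false; intros w [= <-] E.
        apply code_inj, app_inj_tail in E as [_ E]; discriminate.
      - exists true; intros w [= <-]; exact N. }
    exists (l ++ [b]); split; [rewrite length_app; simpl; lia|].
    intros e He v Hv; rewrite firstn_app.
    destruct (Nat.eq_dec e k) as [-> | N].
    - rewrite firstn_all2 by lia; replace (S k - length l) with 1 by lia; now apply Hb.
    - replace (S e - length l) with 0 by lia; rewrite app_nil_r; apply IH; [lia | trivial]. }
  destruct (H n) as (l & Hl & Hn); exists l; split; [trivial|].
  unfold tree; now rewrite Hl.
Qed.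

(** Diagonalization: if the path stayed in the tree, a program [e] computing its prefix of length
    [k + 1] from [k] would, on input [e], output the very prefix that the tree excludes. *)
Lemma no_decidable_path (C : list bool -> Prop) :
  dec (fun x => C (node x)) -> exists l, along C l /\ ~ tree l.
Proof.
  intros HC; apply NNPP; intros N.
  assert (forall l, along C l -> tree l) as Hall.
  { intros l Hl; apply NNPP; intros H; apply N; eauto. }
  destruct (comp_least (fun k c => length (node c) = S k /\
    forall i, i < S k -> (nth i (node c) false = true <-> C (firstn i (node c)))))
    as (f & [e He] & Hf).
  - assert (dec (fun z => C (node (code (firstn (pi2 z) (node (pi2 (pi1 z)))))))) as H.
    { apply (dec_app (fun x => C (node x)) (fun z => code (firstn (pi2 z) (node (pi2 (pi1 z)))))); dec. }
    apply (dec_ext (fun z => length (node (pi2 z)) = S (pi1 z) /\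
      forall i, i < S (pi1 z) -> (nth i (node (pi2 z)) false = true <->
        C (node (code (firstn i (node (pi2 z)))))))); [|dec].
    intros z; split; intros [H1 H2]; split; trivial; intros i Hi; specialize (H2 i Hi);
      rewrite node_code in *; trivial.
  - intros k; destruct (along_exists C (S k)) as (l & Hl & H); exists (code l).
    rewrite node_code; split; [trivial|]; rewrite <- Hl; now apply along_nth.
  - destruct (He e) as [n Hn], (Hf e) as [[Hlen Hbit] _].
    rewrite <- Hlen in Hbit; apply along_nth in Hbit.
    (* The level lies beyond [e] and beyond the number [n] of steps after which the output of [e]
       appears. *)
    destruct (along_exists C (max n (S e))) as (l & Hl & Ha).
    apply (Hall l Ha e) with (v := f e); [lia | |].
    + rewrite Hl; apply (run_mono _ _ _ _ _ _ Hn); lia.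
    + rewrite <- (code_node (f e)); f_equal; apply (along_unique C); trivial.
      * rewrite length_firstn; lia.
      * now apply along_firstn.
Qed.

(** * The ordered space of the Kleene tree *)

Definition ktree (x : nat) : Prop := tree (node x).

Definition prec (x y : nat) : Prop := before (node x) (node y) = true.

Definition korder (z : nat) : Prop :=
  exists x y, z = np x y /\ ktree x /\ ktree y /\ prec x y.

Lemma dec_ktree : dec ktree.
Proof. exact dec_tree. Qed.

Lemma korder_np x y : korder (np x y) <-> ktree x /\ ktree y /\ prec x y.
Proof.
  split; [|unfold korder; eauto].
  intros (x' & y' & [-> ->]%np_inj & H); exact H.
Qed.

Lemma dec_korder : dec korder.
Proof.
  pose proof dec_ktree.
  apply (dec_ext (fun z => z = np (np1 z) (np2 z) /\ ktree (np1 z) /\ ktree (np2 z) /\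
    before (node (np1 z)) (node (np2 z)) = true)); [|dec].
  intros z; split.
  - intros H'; exists (np1 z), (np2 z); exact H'.
  - intros (x & y & -> & H'); rewrite np1_np, np2_np; auto.
Qed.

Lemma prec_irrefl x : ~ prec x x.
Proof. unfold prec; now rewrite before_irrefl. Qed.

Lemma prec_trans x y z : prec x y -> prec y z -> prec x z.
Proof. apply before_trans. Qed.

Lemma prec_total x y : prec x y \/ x = y \/ prec y x.
Proof.
  destruct (before_total (node x) (node y)) as [H | [H | H]]; auto.
  right; left; now rewrite <- (code_node x), H, code_node.
Qed.

(** Without endpoints the path that turns right at the elements of [A] would stay in the tree by
    [along_gap], yet it is decidable because [A] is. *)
Lemma korder_complete (A B : nat -> Prop) :
  dec A -> dec B ->
  (forall x, ktree x <-> A x \/ B x) ->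
  (forall x y, A x /\ B y -> korder (np x y)) ->
  (exists m, A m /\ forall x, A x -> ~ korder (np m x)) \/
  (exists m, B m /\ forall x, B x -> ~ korder (np x m)).
Proof.
  intros HA HB Hpart Hlt; apply NNPP; intros N.
  assert (forall l, tree l <-> A (code l) \/ B (code l)) as Ht.
  { intros l; rewrite <- Hpart; unfold ktree; now rewrite node_code. }
  destruct (no_decidable_path (fun l => A (code l))) as (l & Hl & Hn).
  { apply (dec_ext A); [intros x; now rewrite code_node | trivial]. }
  apply Hn, Ht; revert Hl; apply (along_gap l (fun l => A (code l)) (fun l => B (code l))).
  - apply (Ht []); intros e He; simpl in He; lia.
  - intros b m H k; rewrite <- Ht in *; now apply tree_firstn.
  - intros x y Hx Hy.
    destruct (proj1 (korder_np _ _) (Hlt _ _ (conj Hx Hy))) as (_ & _ & H).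
    unfold prec in H; now rewrite !node_code in H.
  - intros m Hm; apply NNPP; intros H; apply N; left; exists (code m); split; [trivial|].
    intros x Hx (_ & _ & L)%korder_np; apply H; exists (node x); rewrite code_node.
    unfold prec in L; now rewrite node_code in L.
  - intros m Hm; apply NNPP; intros H; apply N; right; exists (code m); split; [trivial|].
    intros x Hx (_ & _ & L)%korder_np; apply H; exists (node x); rewrite code_node.
    unfold prec in L; now rewrite node_code in L.
Qed.

(** * Extended points and intervals *)

Definition ext_in (X : nat -> Prop) (u : nat) : Prop :=
  u = 0 \/ u = 1 \/ exists x, X x /\ u = x + 1 + 1.

Definition ext_less (L : nat -> Prop) (u v : nat) : Prop :=
  (u = 0 /\ ~ v = 0) \/ (~ u = 1 /\ v = 1) \/
  exists x y, u = x + 1 + 1 /\ v = y + 1 + 1 /\ L (np x y).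

Lemma dec_ext_in X f : dec X -> comp f -> dec (fun z => ext_in X (f z)).
Proof.
  intros HX Hf.
  (* The only candidate is [f z - 2]; subtraction is truncated, so the equation tests that [f z] is
     at least 2. *)
  apply (dec_ext (fun z => f z = 0 \/ f z = 1 \/ (X (f z - 2) /\ f z = f z - 2 + 1 + 1)));
    [|dec].
  intros z; unfold ext_in; split; intros [H | [H | H]]; auto; right; right.
  - eauto.
  - destruct H as (x & Hx & ->); replace (x + 1 + 1 - 2) with x by lia; auto.
Qed.

Lemma dec_ext_less L f g :
  dec L -> comp f -> comp g -> dec (fun z => ext_less L (f z) (g z)).
Proof.
  intros HL Hf Hg.
  apply (dec_ext (fun z => (f z = 0 /\ ~ g z = 0) \/ (~ f z = 1 /\ g z = 1) \/
    (f z = f z - 2 + 1 + 1 /\ g z = g z - 2 + 1 + 1 /\ L (np (f z - 2) (g z - 2))))); [|dec].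
  intros z; unfold ext_less; split; intros [H | [H | H]]; auto; right; right.
  - eauto.
  - destruct H as (x & y & -> & -> & H).
    replace (x + 1 + 1 - 2) with x by lia; replace (y + 1 + 1 - 2) with y by lia; auto.
Qed.

(** The projections recover the components of the code, and the quotient is at most the dividend, as
    the divisor is positive. *)
Lemma dec_fin_in f g : comp f -> comp g -> dec (fun z => fin_in (f z) (g z)).
Proof.
  intros Hf Hg.
  apply (dec_ext (fun z =>
    g z = np (np1 (g z)) (np (np1 (np2 (g z))) (np2 (np2 (g z)))) /\ f z < np1 (g z) /\
    exists q, q < S (np2 (np2 (g z))) /\
      np2 (np2 (g z)) = (np1 (np2 (g z)) * (f z + 1) + 1) * q)).
  - intros z; split.
    + intros (E & H & q & _ & Hq); exists (np1 (g z)), (np1 (np2 (g z))), (np2 (np2 (g z))).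
      repeat split; eauto.
    + intros (k & m & n & -> & H & q & Hq); repeat (rewrite np1_np || rewrite np2_np).
      repeat split; trivial; exists q; split; [nia | trivial].
  - dec.
Qed.

Lemma ext_less_mem x y : ext_less korder (x + 1 + 1) (y + 1 + 1) <-> korder (np x y).
Proof.
  split.
  - intros [H | [H | (x' & y' & E & E' & H)]]; try lia.
    now replace x with x' by lia; replace y with y' by lia.
  - intros H; right; right; eauto.
Qed.

(* Since [u] and [v] lie above level [n], an interval without nodes of level [n]
   is finite. *)
Definition thin (n i : nat) : Prop :=
  exists u v, i = np u v /\ ext_in ktree u /\ ext_in ktree v /\ u < n /\ v < n /\
    forall y, y < 2 ^ S n -> ktree y -> length (node y) = n ->
      ~ (ext_less korder u (y + 1 + 1) /\ ext_less korder (y + 1 + 1) v).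

(** Decidability rests on the bound [2 ^ S n], which exceeds all codes of strings of length [n]. *)
Lemma dec_thin f g : comp f -> comp g -> dec (fun z => thin (f z) (g z)).
Proof.
  intros Hf Hg; pose proof dec_ktree; pose proof dec_korder.
  apply (dec_ext (fun z => g z = np (np1 (g z)) (np2 (g z)) /\
    ext_in ktree (np1 (g z)) /\ ext_in ktree (np2 (g z)) /\
    np1 (g z) < f z /\ np2 (g z) < f z /\
    forall y, y < 2 ^ S (f z) -> ktree y -> length (node y) = f z ->
      ~ (ext_less korder (np1 (g z)) (y + 1 + 1) /\
         ext_less korder (y + 1 + 1) (np2 (g z))))).
  - intros z; split.
    + intros H'; exists (np1 (g z)), (np2 (g z)); exact H'.
    + intros (u & v & -> & H'); rewrite np1_np, np2_np; auto.
  - dec; first [apply dec_ext_in | apply dec_ext_less]; dec.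
Qed.

(** A longer node of the interval would have its prefix of length [n] there too, since finite
    endpoints are shorter than [n] and cannot distinguish the two. *)
Lemma thin_bounded n u v x :
  thin n (np u v) -> ext_less korder u (x + 1 + 1) -> ext_less korder (x + 1 + 1) v ->
  ktree x -> x < 2 ^ n.
Proof.
  intros (u' & v' & [<- <-]%np_inj & Hu & Hv & Lu & Lv & H) Hux Hxv Hx.
  destruct (Nat.lt_ge_cases (length (node x)) n) as [L | L].
  - pose proof (code_lt_pow (node x)) as P; rewrite code_node in P.
    pose proof (Nat.pow_le_mono_r 2 (S (length (node x))) n); lia.
  - exfalso.
    set (y := code (firstn n (node x))).
    assert (length (firstn n (node x)) = n) as Ly by (rewrite length_firstn; lia).
    assert (node y = firstn n (node x)) as Ey by apply node_code.
    assert (ktree y) as Hy by (unfold ktree; rewrite Ey; now apply tree_firstn).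
    apply (H y); trivial.
    + pose proof (code_lt_pow (firstn n (node x))) as P; rewrite Ly in P; unfold y; lia.
    + now rewrite Ey.
    + split.
      * destruct Hux as [Hux | [Hux | (w & w' & -> & E & Hw)]]; [left; lia | lia |].
        replace w' with x in Hw by lia; apply korder_np in Hw as (Hw & _ & P).
        apply ext_less_mem, korder_np; repeat split; trivial; unfold prec; rewrite Ey.
        rewrite before_firstn_r; [exact P | pose proof (length_node w); lia].
      * destruct Hxv as [Hxv | [Hxv | (w' & w & E & -> & Hw)]]; [lia | right; left; lia |].
        replace w' with x in Hw by lia; apply korder_np in Hw as (_ & Hw & P).
        apply ext_less_mem, korder_np; repeat split; trivial; unfold prec; rewrite Ey.
        rewrite before_firstn_l; [exact P | pose proof (length_node w); lia].
Qed.

(** Supplies the nearest neighbours of a point among finitely many nodes, with [R] reversed for the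
    upper one. *)
Lemma finite_max (R : nat -> nat -> Prop) (P : nat -> Prop) n :
  (forall x, ~ R x x) -> (forall x y z, R x y -> R y z -> R x z) ->
  (forall x, x < n -> ~ P x) \/ exists m, P m /\ forall x, x < n -> P x -> ~ R m x.
Proof.
  intros Hir Htr; induction n as [|n IH]; [left; lia|].
  destruct (classic (P n)) as [H | H].
  - destruct IH as [IH | (m & Hm & IH)].
    + right; exists n; split; [trivial|]; intros x Hx Px.
      destruct (Nat.eq_dec x n) as [-> | N]; [auto | destruct (IH x); trivial; lia].
    + right; destruct (classic (R m n)) as [HR | HR].
      * exists n; split; [trivial|]; intros x Hx Px K.
        destruct (Nat.eq_dec x n) as [-> | N]; [now apply Hir in K|].
        apply (IH x); [lia | trivial | eauto].
      * exists m; split; [trivial|]; intros x Hx Px.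
        destruct (Nat.eq_dec x n) as [-> | N]; [trivial | apply IH; [lia | trivial]].
  - destruct IH as [IH | (m & Hm & IH)].
    + left; intros x Hx; destruct (Nat.eq_dec x n) as [-> | N]; [trivial | apply IH; lia].
    + right; exists m; split; [trivial|]; intros x Hx Px.
      destruct (Nat.eq_dec x n) as [-> | N]; [tauto | apply IH; [lia | trivial]].
Qed.

Lemma ext_less_up u y a :
  ext_less korder u (y + 1 + 1) -> ktree a -> prec y a -> ext_less korder u (a + 1 + 1).
Proof.
  intros [H | [H | (w & y' & -> & E & H)]] Ha P; [left; lia | lia |].
  replace y' with y in H by lia; apply korder_np in H as (Hw & _ & H).
  apply ext_less_mem, korder_np; eauto using prec_trans.
Qed.

Lemma ext_less_down v y a :
  ext_less korder (y + 1 + 1) v -> ktree a -> prec a y -> ext_less korder (a + 1 + 1) v.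
Proof.
  intros [H | [H | (y' & w & E & -> & H)]] Ha P; [lia | right; left; lia |].
  replace y' with y in H by lia; apply korder_np in H as (_ & Hw & H).
  apply ext_less_mem, korder_np; eauto using prec_trans.
Qed.

(* The paths that turn left, resp. right, at [x] and straight back towards [x]
   afterwards are decidable, hence leave the tree; beyond that level no node is
   adjacent to [x]. *)
Lemma thin_cover x : ktree x ->
  exists n u v, thin n (np u v) /\
    ext_less korder u (x + 1 + 1) /\ ext_less korder (x + 1 + 1) v.
Proof.
  intros Hx.
  destruct (no_decidable_path (fun a => before a (node x) = true)) as (l & Hl & Nl);
    [apply (dec_before (fun a => a) (fun _ => x)); dec|].
  destruct (no_decidable_path (fun a => ~ before (node x) a = true)) as (l' & Hl' & Nl');
    [apply dec_not, (dec_before (fun _ => x) (fun a => a)); dec|].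
  (* All proper prefixes of [l] and [l'] have codes below [M]; [u] and [v] will be the neighbours of
     [x] among the tree nodes below [M], or infinite if there are none. *)
  set (M := 2 ^ S (length l + length l')).
  assert (exists u, ext_in ktree u /\ ext_less korder u (x + 1 + 1) /\
    forall a, a < M -> ktree a -> prec a x -> ~ ext_less korder u (a + 1 + 1)) as (u & Iu & Ux & Hu).
  { destruct (finite_max prec (fun a => ktree a /\ prec a x) M prec_irrefl prec_trans)
      as [H | (m & [Tm Pm] & H)].
    - exists 0; split; [now left | split; [left; lia|]].
      intros a La Ta Pa; destruct (H a La); auto.
    - exists (m + 1 + 1); split; [right; right; eauto | split].
      + now apply ext_less_mem, korder_np.
      + intros a La Ta Pa (_ & _ & K)%ext_less_mem%korder_np; exact (H a La (conj Ta Pa) K). }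
  assert (exists v, ext_in ktree v /\ ext_less korder (x + 1 + 1) v /\
    forall a, a < M -> ktree a -> prec x a -> ~ ext_less korder (a + 1 + 1) v) as (v & Iv & Vx & Hv).
  { destruct (finite_max (fun a b => prec b a) (fun a => ktree a /\ prec x a) M prec_irrefl)
      as [H | (m & [Tm Pm] & H)]; [eauto using prec_trans | |].
    - exists 1; split; [right; now left | split; [right; left; lia|]].
      intros a La Ta Pa; destruct (H a La); auto.
    - exists (m + 1 + 1); split; [right; right; eauto | split].
      + now apply ext_less_mem, korder_np.
      + intros a La Ta Pa (_ & _ & K)%ext_less_mem%korder_np; exact (H a La (conj Ta Pa) K). }
  (* The level exceeds [u] and [v] as thinness demands, the lengths of both paths, and [x], so that
     [x] itself is not on it. *)
  exists (S (length l + length l' + u + v + x)), u, v; split; [|auto].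
  exists u, v; do 5 (split; [trivial; lia|]); intros y _ Ty Ly [Uy Vy].
  assert (forall i, i < length l + length l' ->
    exists a, node a = firstn i (node y) /\ a < M /\ ktree a) as Hpre.
  { intros i Hi; exists (code (firstn i (node y))); rewrite node_code; split; [trivial | split].
    - pose proof (code_lt_pow (firstn i (node y))) as P.
      rewrite length_firstn, Nat.min_l in P by lia.
      pose proof (Nat.pow_le_mono_r 2 (S i) (S (length l + length l'))); unfold M; lia.
    - unfold ktree; rewrite node_code; now apply tree_firstn. }
  destruct (prec_total y x) as [P | [-> | P]].
  (* Either [y] extends [l], which is not in the tree, or it leaves [l] at a node [a] below [M]. If
     [a] precedes [x], it lies between [u] and [x]; otherwise [y] could not precede [x]. *)
  - destruct (along_diverge _ l (node y) Hl) as [E | (i & Hi & K)]; [lia | |].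
    + apply Nl; rewrite <- E; now apply tree_firstn.
    + destruct (Hpre i) as (a & Ea & La & Ta); [lia|]; rewrite <- Ea in K.
      destruct K as [[K1 K2] | [K1 K2]]; [|exact (K1 (before_trans _ _ _ K2 P))].
      exact (Hu a La Ta K1 (ext_less_up _ _ _ Uy Ta K2)).
  - pose proof (length_node x); lia.
  - destruct (along_diverge _ l' (node y) Hl') as [E | (i & Hi & K)]; [lia | |].
    + apply Nl'; rewrite <- E; now apply tree_firstn.
    + destruct (Hpre i) as (a & Ea & La & Ta); [lia|]; rewrite <- Ea in K.
      destruct K as [[K1 K2] | [K1 K2]]; [exact (K1 (before_trans _ _ _ P K2))|].
      exact (Hv a La Ta (NNPP _ K1) (ext_less_down _ _ _ Vy Ta K2)).
Qed.

(** * The space in the model and its cover by finite intervals *)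

Definition ext_max_of (L : nat -> Prop) (u v w : nat) : Prop :=
  (ext_less L u v /\ w = v) \/ (~ ext_less L u v /\ w = u).

Definition ext_min_of (L : nat -> Prop) (u v w : nat) : Prop :=
  (ext_less L u v /\ w = u) \/ (~ ext_less L u v /\ w = v).

(** This set and the next two copy the defining formulas in [ordered_space], whose equivalences then
    hold by reflexivity. *)
Definition space_index (z : nat) : Prop :=
  exists u v, z = np u v /\ ext_in ktree u /\ ext_in ktree v.

Definition space_open (z : nat) : Prop :=
  exists x u v, z = np x (np u v) /\ ktree x /\ space_index (np u v) /\
    ext_less korder u (x + 1 + 1) /\ ext_less korder (x + 1 + 1) v.

Definition space_meet (z : nat) : Prop :=
  exists x u v u' v' w w',
    z = np (np (np x (np u v)) (np u' v')) (np w w') /\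
    ktree x /\ space_index (np u v) /\ space_index (np u' v') /\
    ext_max_of korder u u' w /\ ext_min_of korder v v' w'.

Lemma dec_space_index : dec space_index.
Proof.
  apply (dec_ext (fun z => z = np (np1 z) (np2 z) /\
    ext_in ktree (np1 z) /\ ext_in ktree (np2 z))).
  - intros z; split.
    + intros H; exists (np1 z), (np2 z); exact H.
    + intros (u & v & -> & H); rewrite np1_np, np2_np; auto.
  - pose proof dec_ktree; dec; apply dec_ext_in; dec.
Qed.

Lemma dec_space_open : dec space_open.
Proof.
  apply (dec_ext (fun z => z = np (np1 z) (np (np1 (np2 z)) (np2 (np2 z))) /\
    ktree (np1 z) /\ space_index (np (np1 (np2 z)) (np2 (np2 z))) /\
    ext_less korder (np1 (np2 z)) (np1 z + 1 + 1) /\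
    ext_less korder (np1 z + 1 + 1) (np2 (np2 z)))).
  - intros z; split.
    + intros H; do 3 eexists; exact H.
    + intros (x & u & v & -> & H); repeat (rewrite np1_np || rewrite np2_np); auto.
  - pose proof dec_ktree; pose proof dec_korder; pose proof dec_space_index.
    dec; apply dec_ext_less; dec.
Qed.

Lemma dec_space_meet : dec space_meet.
Proof.
  apply (dec_ext (fun z =>
    z = np (np (np (np1 (np1 (np1 z))) (np (np1 (np2 (np1 (np1 z)))) (np2 (np2 (np1 (np1 z))))))
          (np (np1 (np2 (np1 z))) (np2 (np2 (np1 z)))))
        (np (np1 (np2 z)) (np2 (np2 z))) /\
    ktree (np1 (np1 (np1 z))) /\
    space_index (np (np1 (np2 (np1 (np1 z)))) (np2 (np2 (np1 (np1 z))))) /\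
    space_index (np (np1 (np2 (np1 z))) (np2 (np2 (np1 z)))) /\
    ext_max_of korder (np1 (np2 (np1 (np1 z)))) (np1 (np2 (np1 z))) (np1 (np2 z)) /\
    ext_min_of korder (np2 (np2 (np1 (np1 z)))) (np2 (np2 (np1 z))) (np2 (np2 z)))).
  - intros z; split.
    + intros H; do 7 eexists; exact H.
    + intros (x & u & v & u' & v' & w & w' & -> & H).
      repeat (rewrite np1_np || rewrite np2_np); auto.
  - pose proof dec_ktree; pose proof dec_korder; pose proof dec_space_index.
    unfold ext_max_of, ext_min_of; dec; apply dec_ext_less; dec.
Qed.

Lemma cover_enumeration :
  exists f, comp f /\ forall n i, fin_in i (f n) <-> i < n /\ exists m, m < n /\ thin m i.
Proof.
  (* Elements of [c] are below [c] and the wanted ones below [n], so testing [i < n + c] suffices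
     and keeps the search decidable. *)
  destruct (comp_least (fun n c => forall i, i < n + c ->
    (fin_in i c <-> i < n /\ exists m, m < n /\ thin m i))) as (f & Hf & H).
  - apply (dec_all_lt (fun z => pi1 z + pi2 z) (fun z i =>
      fin_in i (pi2 z) <-> i < pi1 z /\ exists m, m < pi1 z /\ thin m i)); [dec|].
    apply dec_iff; [apply dec_fin_in; dec | apply dec_and; [dec|]].
    apply (dec_ex_lt (fun z => pi1 (pi1 z)) (fun z m => thin m (pi2 z))); [dec|].
    apply dec_thin; dec.
  - intros n; destruct (fin_in_exists (fun i => exists m, m < n /\ thin m i) n) as [c Hc].
    exists c; intros i _; apply Hc.
  - exists f; split; [trivial|]; intros n i; destruct (H n) as [Hn _]; split.
    + intros K; apply Hn; [apply fin_in_lt in K; lia | trivial].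
    + intros K; apply Hn; [lia | trivial].
Qed.

Lemma space_not_compact :
  exists A, dec A /\
    (forall z, A z -> exists n a, z = np n a) /\
    (forall n, exists a, A (np n a) /\ forall b, A (np n b) -> b = a) /\
    (forall m n a b, (m < n \/ m = n) /\ A (np m a) /\ A (np n b) ->
      forall x, fin_in x a -> fin_in x b) /\
    (forall i, (exists n a, A (np n a) /\ fin_in i a) -> space_index i) /\
    (forall x, ktree x <->
      exists i, (exists n a, A (np n a) /\ fin_in i a) /\ space_open (np x i)) /\
    ~ exists a, (forall i, fin_in i a -> exists n a, A (np n a) /\ fin_in i a) /\
        forall x, ktree x -> exists i, fin_in i a /\ space_open (np x i).
Proof.
  destruct cover_enumeration as (f & Hf & Ef).
  set (A z := exists n, z = np n (f n)).
  assert (forall n a, A (np n a) <-> a = f n) as HA.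
  { intros n a; split; [intros (m & [-> ->]%np_inj); trivial | intros ->; now exists n]. }
  assert (forall i, (exists n a, A (np n a) /\ fin_in i a) <-> exists m, thin m i) as Hi.
  { intros i; split.
    - intros (n & a & ->%HA & (_ & m & _ & H)%Ef); eauto.
    (* By this stage both the interval [i] and its level [m] are below the bound. *)
    - intros [m H]; exists (S (m + i)), (f (S (m + i))); split; [now apply HA|].
      apply Ef; split; [lia | exists m; split; [lia | trivial]]. }
  exists A; split.
  { apply (dec_ext (fun z => z = np (np1 z) (f (np1 z)))).
    - intros z; split; [intros H; now exists (np1 z) | intros (n & ->); now rewrite np1_np].
    - dec. }
  split; [intros z (n & ->); eauto|].
  split; [intros n; exists (f n); split; [now apply HA | intros b; apply HA]|].
  split.
  { intros m n a b (Hmn & ->%HA & ->%HA) x (Hx & k & Hk & Ht)%Ef.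
    apply Ef; split; [lia | exists k; split; [lia | trivial]]. }
  split.
  { intros i (m & u & v & -> & Hu & Hv & _)%Hi; exists u, v; auto. }
  split.
  { intros x; split.
    - intros Hx; destruct (thin_cover x Hx) as (n & u & v & Ht & Hux & Hxv).
      exists (np u v); split; [apply Hi; eauto|]; exists x, u, v.
      repeat split; trivial; destruct Ht as (u' & v' & E & Hu & Hv & _).
      exists u', v'; auto.
    - intros (i & _ & x' & u & v & [<- _]%np_inj & Hx & _); exact Hx. }
  intros (a & Ha & Hcov).
  (* Finitely many thin intervals have a bounded union, since each one at level [m] stays below
     [2 ^ m]. *)
  assert (forall k, exists N, forall i, i < k -> fin_in i a ->
    forall x, space_open (np x i) -> x < N) as HN.
  { induction k as [|k [N IH]]; [exists 0; lia|].
    destruct (classic (fin_in k a)) as [Hk | Hk].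
    - destruct (proj1 (Hi k) (Ha k Hk)) as [m Hm]; exists (N + 2 ^ m); intros i Li Fi x Hx.
      destruct (Nat.eq_dec i k) as [-> | D].
      + destruct Hx as (x' & u & v & [<- ->]%np_inj & Hx & _ & Hux & Hxv).
        pose proof (thin_bounded m u v x Hm Hux Hxv Hx); lia.
      + specialize (IH i ltac:(lia) Fi x Hx); lia.
    - exists N; intros i Li Fi; destruct (Nat.eq_dec i k) as [-> | D]; [easy|].
      apply IH; [lia | trivial]. }
  (* The elements of the finite set are below its code [a]; a tree node of length [N] has code at
     least [N] and remains uncovered. *)
  destruct (HN a) as [N H], (tree_infinite N) as (l & Ll & Tl).
  destruct (Hcov (code l)) as (i & Fi & Oi).
  - unfold ktree; now rewrite node_code.
  - pose proof (H i (fin_in_lt _ _ Fi) Fi _ Oi); pose proof (length_le_code l); lia.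
Qed.

(** * Evaluation of the statement in the model *)

Theorem mainTheorem3 : ~ proves RCA0 complete_orders_compact.
Proof.
  intros Hp.
  assert (sat dec (fun _ => 0) (fun _ _ => False) complete_orders_compact) as H.
  { apply (soundness dec _ _ _ Hp).
    - intros q s R Hq HR; now apply RCA0_sat.
    - intros _; apply (dec_ext (fun x => x < 0)); [lia | dec].
    - intros q []. }
  destruct space_not_compact as (A & HA & A1 & A2 & A3 & A4 & A5 & A6).
  specialize (H ktree dec_ktree korder dec_korder); cbn in H.
  assert (forall x, iff x x) as Rf by tauto.
  (* Linearity and completeness are left as goals; the space and the cover are supplied here. *)
  apply A6; destruct (fun lin cpl => H (conj lin cpl) space_index dec_space_index
    space_open dec_space_open space_meet dec_space_meet
    (conj (fun z => Rf (space_index z))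
       (conj (fun z => Rf (space_open z)) (fun z => Rf (space_meet z))))
    A HA (conj (conj (conj A1 A2) A3) (conj A4 A5))) as (a & Ha & Hcov).
  - repeat split.
    + intros z (x & y & H'); exists x, y; tauto.
    + intros x _ (_ & _ & K)%korder_np; now apply prec_irrefl in K.
    + intros x y z _ [(Hx & _ & K)%korder_np (_ & Hz & K')%korder_np].
      apply korder_np; eauto using prec_trans.
    + intros x y [Hx Hy]; destruct (prec_total x y) as [K | [K | K]].
      * left; now apply korder_np.
      * now right; left.
      * right; right; now apply korder_np.
  - intros P DP Q DQ (Hpart & _ & Hlt); exact (korder_complete P Q DP DQ Hpart Hlt).
  - exists a; split; [exact Ha|]; intros x; exact (proj1 (Hcov x)).
Qed.
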